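(* If $G$ is a finitely generated virtually abelian group, then $G_{bound}$ is finite.
   Context: For a finitely generated group $G$, a finite generating set $S$ of $G$ and $g\in G$, the word-length $l_S(g)$ is the minimal integer $n\ge 0$ such that $g$ is a product of $n$ elements of $S\cup S^{-1}$. $G_{bound}$ denotes the set of all $g\in G$ for which there exists a constant $M>0$ such that $l_S(g)<M$ for every finite generating set $S$ of $G$; it is a subgroup of $G$. *)

(* Defs.v *)
From HB Require Import structures.
From mathcomp Require Import all_boot.
From mathcomp Require Import all_classical.

Set Implicit Arguments.
Unset Strict Implicit.
Unset Printing Implicit Defensive.

Local Open Scope classical_set_scope.
Local Open Scope group_scope.

Section WordLength.
Variable G : groupType.
Implicit Types (S : set G) (g : G) (n : nat).

Definition letters S : set G := S `|` [set x^-1 | x in S].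

Definition prod_of_letters S n g : Prop :=
  exists w : seq G,
    [/\ size w = n, forall x, x \in w -> letters S x & g = \prod_(x <- w) x].

Definition generating S : Prop := forall g, exists n, prod_of_letters S n g.

(* The value is the junk 0 when g is not in the subgroup generated by S;
   see word_lengthP for generating S. *)
Definition word_length S g : nat :=
  xget 0%N [set n | prod_of_letters S n g
                    /\ forall m, prod_of_letters S m g -> (n <= m)%N].

Lemma word_lengthP S g : generating S ->
  prod_of_letters S (word_length S g) g
  /\ forall n, prod_of_letters S n g -> (word_length S g <= n)%N.
Proof.
move=> genS; rewrite /word_length.
case: xgetP => [n _ //|nomin].
have ex : exists n, `[< prod_of_letters S n g >].
  by have [n Pn] := genS g; exists n; apply/asboolP.
have [m /asboolP Pm minm] := ex_minnP ex.
by case: (nomin m); split=> // k Pk; apply/minm/asboolP.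
Qed.

End WordLength.

Definition finitely_generated (G : groupType) : Prop :=
  exists2 S : set G, finite_set S & generating S.

Definition G_bound (G : groupType) : set G :=
  [set g | exists2 M : nat, (0 < M)%N &
     forall S : set G, finite_set S -> generating S ->
       (word_length S g < M)%N].

Arguments G_bound : clear implicits.

(* Subgroups of G are the boolean predicates of type groupClosed G; by
   classical logic this loses no generality. *)
Definition finite_index (G : groupType) (H : groupClosed G) : Prop :=
  finite_set [set [set g * h | h in [set h | h \in H]] | g in [set: G]].

Definition virtually_abelian (G : groupType) : Prop :=
  exists2 H : groupClosed G, finite_index H & {in H &, forall x y, commute x y}.

(* Main.v *)
Require Import Defs.
From mathcomp Require Import all_boot all_classical.
From HB Require Import structures.
From mathcomp Require Import all_algebra zify.

Set Implicit Arguments.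
Unset Strict Implicit.
Unset Printing Implicit Defensive.

Import GRing.Theory.

Local Open Scope classical_set_scope.
Local Open Scope ring_scope.

(** The model case is G = Z. The set {N, N^2 - N + 1} generates Z, and if a
fixed g is a combination u N + v (N^2 - N + 1) with u, v bounded independently
of N, then two integers u, v serve for three values of N; a polynomial of
degree two in N that takes the value g three times is constant, so u = v = 0
and g = 0.

In general let A be an abelian normal subgroup of finite index m. The role of
multiplication by N is played by an endomorphism of G that induces the N-th
power on A and the identity on G / A. It exists for each N = m n + 1. Indeed
the extension class of G is killed by m, which is made explicit by the crossed
homomorphism c : G -> A, the product over the cosets x of g s(x) s(gx)^-1 for
a section s (lemma transferM); it restricts to the m-th power on A, and
phi_n : g |-> c(g)^n g is the wanted endomorphism (stretchM, stretch_emb).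

Fix a finite generating set S, put N = m n + 1 and N' = (N - 1) N + 1, which is
m n' + 1 for n' = n N. The images phi_n(S) and phi_n'(S) together generate G
(generating_stretched): their span contains the N-th and N'-th powers of each
a in A, hence a, because N' - (N - 1) N = 1. As c (phi_n g) = N c(g), the value
of c at a product of fewer than M letters is u N + v N' with (u, v) in a finite
set that does not depend on n (transfer_word). So for g in G_bound three
values of n share the same u and v, and c(g) is torsion
(torsion_transfer_bound).

Finally only finitely many g have c(g) torsion. On each coset of A two such
elements differ by a torsion element of A, since c restricts to the m-th power;
and A, of finite index in a finitely generated group, is finitely generated
(zspan_schreier), so that its torsion is finite (finite_torsion_zspan). *)

(** * Torsion in abelian groups *)

Section Torsion.
Variable V : zmodType.
Implicit Types (a u v x : V) (d : seq V).

Definition torsion v : Prop := exists2 n, (0 < n)%N & v *+ n = 0.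

Lemma torsionD u v : torsion u -> torsion v -> torsion (u + v).
Proof.
move=> [i i0 ui] [j j0 vj]; exists (i * j)%N; first by rewrite muln_gt0 i0.
by rewrite mulrnDl mulrnA ui mul0rn mulnC mulrnA vj mul0rn addr0.
Qed.

Lemma torsionN v : torsion v -> torsion (- v).
Proof. by move=> [i i0 vi]; exists i => //; rewrite mulNrn vi oppr0. Qed.

Lemma torsionB u v : torsion u -> torsion v -> torsion (u - v).
Proof. by move=> tu tv; apply/torsionD/torsionN. Qed.

Lemma torsionMn v n : torsion v -> torsion (v *+ n).
Proof. by move=> [i i0 vi]; exists i => //; rewrite mulrnAC vi mul0rn. Qed.

Lemma torsion_of_Mn v n : (0 < n)%N -> torsion (v *+ n) -> torsion v.
Proof.
move=> n0 [i i0 vi]; exists (n * i)%N; first by rewrite muln_gt0 n0.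
by rewrite mulrnA.
Qed.

Lemma torsion_of_Dr u v : torsion (u + v) -> torsion v -> torsion u.
Proof. by move=> tuv tv; rewrite -(addrK v u); apply: torsionB. Qed.

(** Integer combinations of d, peeling off one generator at a time so that
inductions on d need no manipulation of coefficient vectors. *)
Fixpoint zspan d v : Prop :=
  if d is x :: d' then exists z : int, zspan d' (v - x *~ z) else v = 0.

Lemma zspan0 d : zspan d 0.
Proof. by elim: d => [//|x d IH] /=; exists 0; rewrite mulr0z subr0. Qed.

Lemma zspanD d u v : zspan d u -> zspan d v -> zspan d (u + v).
Proof.
elim: d u v => [|x d IH] u v /=; first by move=> -> ->; rewrite addr0.
move=> [y uy] [z vz]; exists (y + z).
by rewrite mulrzDr opprD addrACA; apply: IH.
Qed.

Lemma zspanN d v : zspan d v -> zspan d (- v).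
Proof.
elim: d v => [|x d IH] v /=; first by move=> ->; rewrite oppr0.
by move=> [y vy]; exists (- y); rewrite mulrNz -opprD; apply: IH.
Qed.

Lemma zspanMn d v n : zspan d v -> zspan d (v *+ n).
Proof.
move=> dv; elim: n => [|n IH]; first by rewrite mulr0n; apply: zspan0.
by rewrite mulrS; apply: zspanD.
Qed.

Lemma zspanMz d v z : zspan d v -> zspan d (v *~ z).
Proof.
by move=> dv; case: z => n; [|apply: zspanN]; apply: zspanMn.
Qed.

Lemma mem_zspan d x : x \in d -> zspan d x.
Proof.
elim: d => [//|y d IH]; rewrite inE => /orP[/eqP ->|xd] /=.
  by exists 1; rewrite mulr1z subrr; apply: zspan0.
by exists 0; rewrite mulr0z subr0; apply: IH.
Qed.

(** Induction on the generators. Let B be the span of d and x one more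
generator. If no positive multiple of x lies in B, a torsion element of B + Zx
has no x-component, so it is in B. If k x lies in B with k > 0, the x-component
may be taken modulo k, and two torsion elements with the same residue differ by
a torsion element of B. *)
Lemma finite_torsion_zspan d : finite_set [set v | zspan d v /\ torsion v].
Proof.
elim: d => [|x d IH].
  by apply: (sub_finite_set _ (finite_set1 0)) => v [].
set B := [set v | _] in IH.
have [[k k0 kx]|nok] := pselect (exists2 k, (0 < k)%N & zspan d (x *+ k)); last first.
  (* No nonzero multiple of x is in the span of d, so its coefficient z is 0. *)
  apply: sub_finite_set IH => v [[z /= dz] tv]; split=> //.
  have -> : v = v - x *~ z + x *~ z by rewrite subrK.
  apply: zspanD => //.
  have [e e0 ve] := tv.
  suff -> : z = 0 by rewrite mulr0z; apply: zspan0.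
  have dze : zspan d (x *~ (z * e)).
    rewrite mulrzA -pmulrn; have := zspanN (zspanMn e dz).
    by rewrite mulrnBl ve sub0r opprK.
  apply: contrapT => z0; apply: nok; exists `|(z * e)%R|%N.
    by rewrite absz_gt0 mulf_neq0 //; [apply/eqP | rewrite -lt0n].
  case: (z * e) dze => n /= dn; rewrite ?absz_nat //.
  by move: (zspanN dn); rewrite NegzE mulrNz opprK.
(* The torsion elements, sorted by the residue of their x-component. *)
have split_fin : finite_set (\bigcup_(i in `I_k)
    [set v | zspan d (v - x *+ i) /\ torsion v]).
  apply: bigcup_finite; first exact: finite_II.
  move=> i _.
  have [[v0 [dv0 tv0]]|none] :=
    pselect (exists v0, zspan d (v0 - x *+ i) /\ torsion v0); last first.
    by apply: (sub_finite_set _ (finite_set0 V)) => v dv; apply: none; exists v.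
  apply: (sub_finite_set _ (finite_image (fun b => b + v0) IH)) => v [dv tv].
  exists (v - v0); last by rewrite subrK.
  split; last exact: torsionB.
  by have := zspanD dv (zspanN dv0); rewrite opprB addrA subrK.
apply: sub_finite_set split_fin => v [[z /= dz] tv].
have kn0 : (k%:Z != 0)%R by rewrite eqz_nat -lt0n.
have r0 := modz_ge0 z kn0.
exists `|(z %% k)%Z|%N; first by
  rewrite /= -ltz_nat gez0_abs //; apply: ltz_pmod; rewrite ltz_nat.
split=> //.
have -> : v - x *+ `|(z %% k)%Z| = v - x *~ z + (x *+ k) *~ (z %/ k)%Z.
  rewrite {2}(divz_eq z k) mulrzDr [(_ * k%:Z)%R]mulrC mulrzA -pmulrn opprD addrA.
  by rewrite [RHS]addrAC subrK pmulrn gez0_abs.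
by apply: zspanD => //; apply: zspanMz.
Qed.

End Torsion.

(** * Quadratic functions of the stretching parameter *)

Section QuadraticValues.
Variables (V : zmodType) (a u v : V).

(* This is u N + v ((N - 1) N + 1) for N = k + 1. *)
Let f k := u *+ k.+1 + v *+ (k * k.+1).+1.

(** The difference f l - f k is l - k times the divided difference that is
claimed to be torsion. *)
Lemma torsion_slope k l : (k < l)%N -> f k = f l ->
  torsion (u + v *+ (k + l).+1).
Proof.
move=> kl fkl.
apply: (@torsion_of_Mn _ _ (l - k)); first by rewrite subn_gt0.
suff -> : (u + v *+ (k + l).+1) *+ (l - k) = f l - f k.
  by rewrite fkl subrr; exists 1%N.
apply/eqP; rewrite eq_sym subr_eq mulrnDl -mulrnA /f.
rewrite addrACA -!mulrnDr; apply/eqP; congr (_ *+ _ + _ *+ _); first by lia.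
by nia.
Qed.

(** Two first divided differences of the quadratic f are torsion, hence so is
the second one, which is v, up to a positive factor; then u and a follow. *)
Lemma torsion_three_values p q r : (p < q)%N -> (q < r)%N ->
  f p = a -> f q = a -> f r = a -> torsion a.
Proof.
move=> pq qr fp fq fr.
have tpq : torsion (u + v *+ (p + q).+1) by apply: torsion_slope; rewrite ?fp ?fq.
have tqr : torsion (u + v *+ (q + r).+1) by apply: torsion_slope; rewrite ?fr ?fq.
have tv : torsion v.
  apply: (@torsion_of_Mn _ _ (r - p)); first by lia.
  have -> : v *+ (r - p) = (u + v *+ (q + r).+1) - (u + v *+ (p + q).+1).
    rewrite opprD addrACA subrr add0r; apply/eqP; rewrite eq_sym subr_eq -mulrnDr; apply/eqP.
    by congr (_ *+ _); lia.
  exact: torsionB.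
have tu : torsion u by apply: torsion_of_Dr tpq _; apply: torsionMn.
by rewrite -fp; apply: torsionD; apply: torsionMn.
Qed.

End QuadraticValues.

(** Pigeonhole for a relation: a candidate t that eventually fails can be dropped
at the price of raising the threshold n0. *)
Lemma infinitely_often (T : eqType) (s : seq T) (R : nat -> T -> Prop) (n0 : nat) :
    (forall n, (n0 <= n)%N -> exists2 t, t \in s & R n t) ->
  exists2 t, t \in s & forall k, exists2 n, (k <= n)%N & R n t.
Proof.
elim: s n0 => [|t s IH] n0 hR; first by have [] := hR n0 (leqnn _).
have [often|] := pselect (forall k, exists2 n, (k <= n)%N & R n t).
  by exists t; rewrite ?mem_head.
move=> /existsNP[k notk].
have [n|t' t's often] := IH (maxn n0 k); last by exists t'; rewrite // inE t's orbT.
rewrite geq_max => /andP[n0n kn]; have [t'] := hR n n0n.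
rewrite inE => /orP[/eqP -> Rn|]; last by exists t'.
by exfalso; apply: notk; exists n.
Qed.

(** * Words in a generating set *)

Section Words.
Variable G : groupType.
Implicit Types (S : set G) (g h l : G).
Local Open Scope group_scope.

Definition generated S : set G := [set g | exists n, prod_of_letters S n g].

Lemma prod_of_letters0 S g : prod_of_letters S 0 g -> g = 1.
Proof. by move=> [w [/size0nil -> _ ->]]; rewrite big_nil. Qed.

Lemma prod_of_lettersS S n g : prod_of_letters S n.+1 g ->
  exists l h, [/\ letters S l, prod_of_letters S n h & g = l * h].
Proof.
move=> [[|l w] []] //= [sw] wS ->; exists l, (\prod_(x <- w) x).
rewrite big_cons; split => //; first by apply: wS; rewrite mem_head.
by exists w; split=> // x xw; apply: wS; rewrite inE xw orbT.
Qed.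

Lemma generated_letter S l : letters S l -> generated S l.
Proof.
by move=> Sl; exists 1%N, [:: l]; split=> [//|x|]; rewrite ?big_seq1 // inE => /eqP ->.
Qed.

Lemma generated1 S : generated S 1.
Proof. by exists 0%N, [::]; split=> //; rewrite big_nil. Qed.

Lemma generatedM S g h : generated S g -> generated S h -> generated S (g * h).
Proof.
move=> [m [w [_ wS ->]]] [n [w' [_ w'S ->]]].
exists (size (w ++ w')), (w ++ w'); split=> //; last by rewrite big_cat.
by move=> x; rewrite mem_cat => /orP[/wS|/w'S].
Qed.

Lemma lettersV S l : letters S l -> letters S l^-1.
Proof. by move=> [Sl|[x Sx <-]]; [right; exists l | left; rewrite invgK]. Qed.

Lemma generatedV S g : generated S g -> generated S g^-1.
Proof.
move=> [n]; elim: n g => [|n IH] g.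
  by move=> /prod_of_letters0 ->; rewrite invg1; apply: generated1.
move=> /prod_of_lettersS[l [h [Sl /IH Sh ->]]]; rewrite invgM.
by apply: generatedM => //; apply/generated_letter/lettersV.
Qed.

End Words.

(** * Extensions of a finite set of cosets by an abelian group *)

(** The injection emb realizes the abelian normal subgroup A of G as an additive
group V, which makes sums over cosets commutative; F stands for the set of
cosets of A, with quotient map pi and section s. *)
Section AbelianExtension.
Variables (G : groupType) (V : zmodType) (F : finType).
Variables (emb : V -> G) (pi : G -> F) (s : F -> G).
Local Open Scope group_scope.
Hypothesis emb_inj : injective emb.
Hypothesis embD : {morph emb : u v / u + v >-> u * v}.
Hypothesis embJ : forall g v, exists u, emb u = g * emb v * g^-1.
Hypothesis piP : forall g h, pi g = pi h <-> exists v, g = h * emb v.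
Hypothesis sK : cancel s pi.
Implicit Types (g h : G) (u v : V) (x y : F).

Lemma emb0 : emb 0 = 1.
Proof. by apply: (@mulgI _ (emb 0)); rewrite -embD addr0 mulg1. Qed.

Lemma embN v : emb (- v) = (emb v)^-1.
Proof. by apply: (@mulgI _ (emb v)); rewrite -embD subrr emb0 mulgV. Qed.

Lemma embC u v : emb u * emb v = emb v * emb u.
Proof. by rewrite -!embD addrC. Qed.

Definition emb_inv g : V := xget 0 [set v | emb v = g].

Lemma emb_invK g : (exists v, emb v = g) -> emb (emb_inv g) = g.
Proof. by rewrite /emb_inv; case: xgetP => [v _ //|nov] [v iv]; case: (nov v). Qed.

Definition act g v : V := emb_inv (g * emb v * g^-1).

Lemma emb_act g v : emb (act g v) = g * emb v * g^-1.
Proof. by rewrite emb_invK. Qed.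

Lemma actD g : {morph act g : u v / u + v}.
Proof.
move=> u v; apply: emb_inj; rewrite embD !emb_act embD.
by rewrite !mulgA mulgVK.
Qed.

Lemma act0 g : act g 0 = 0.
Proof. by apply: emb_inj; rewrite emb_act emb0 mulg1 mulgV. Qed.

Lemma actMn g v n : act g (v *+ n) = act g v *+ n.
Proof. by elim: n => [|n IH]; rewrite ?act0 // !mulrS actD IH. Qed.

Lemma act_sum g (I : Type) (r : seq I) (f : I -> V) :
  act g (\sum_(i <- r) f i)%R = (\sum_(i <- r) act g (f i))%R.
Proof. exact: (big_morph _ (actD g) (act0 g)). Qed.

Lemma act1 v : act 1 v = v.
Proof. by apply: emb_inj; rewrite emb_act mul1g invg1 mulg1. Qed.

Lemma actM g h v : act (g * h) v = act g (act h v).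
Proof. by apply: emb_inj; rewrite !emb_act invgM !mulgA. Qed.

Lemma act_emb u v : act (emb u) v = v.
Proof. by apply: emb_inj; rewrite emb_act embC mulgK. Qed.

Lemma act_pi g h v : pi g = pi h -> act g v = act h v.
Proof. by move=> /piP[u ->]; rewrite actM act_emb. Qed.

Definition smul g x : F := pi (g * s x).

Lemma pi_mul g h : pi (g * h) = smul g (pi h).
Proof.
have /esym/piP[v hv] := sK (pi h).
by apply/piP; exists v; rewrite -mulgA -hv.
Qed.

Lemma smulM g h x : smul (g * h) x = smul g (smul h x).
Proof. by rewrite {1}/smul -mulgA pi_mul. Qed.

Lemma smul1 x : smul 1 x = x.
Proof. by rewrite /smul mul1g sK. Qed.

Lemma smul_inj g : injective (smul g).
Proof.
by apply: (@can_inj _ _ _ (smul g^-1)) => x; rewrite -smulM mulVg smul1.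
Qed.

Lemma smul_emb v x : smul (emb v) x = x.
Proof.
rewrite -[RHS]sK; apply/piP; exists (act (s x)^-1 v).
by rewrite emb_act invgK !mulgA mulgV mul1g.
Qed.

(** The element of A by which the section s fails to be equivariant under g at
the coset x. *)
Definition kappa g x : V := emb_inv (g * s x * (s (smul g x))^-1).

Lemma emb_kappa g x : emb (kappa g x) = g * s x * (s (smul g x))^-1.
Proof.
apply: emb_invK; have /esym/piP[v ->] := sK (smul g x).
by have [u <-] := embJ (s (smul g x)) v; exists u.
Qed.

Lemma kappaM g h x : kappa (g * h) x = kappa g (smul h x) + act g (kappa h x).
Proof.
apply: emb_inj; rewrite addrC embD emb_act !emb_kappa smulM.
by rewrite !mulgA !(mulgVK).
Qed.

Lemma kappa_emb v x : kappa (emb v) x = v.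
Proof. by apply: emb_inj; rewrite emb_kappa smul_emb mulgK. Qed.

(** A crossed homomorphism, by transferM: the cocycle kappa summed over the
cosets, where the translation of the cosets by h only permutes the terms. *)
Definition transfer g : V := (\sum_x kappa g x)%R.

Lemma transferM g h : transfer (g * h) = transfer g + act g (transfer h).
Proof.
rewrite /transfer act_sum [in RHS](reindex_inj (@smul_inj h)) -big_split.
by apply: eq_bigr => x _; rewrite kappaM.
Qed.

Lemma transfer_emb v : transfer (emb v) = v *+ #|F|.
Proof.
rewrite -sumr_const; apply: eq_bigr => x _; exact: kappa_emb.
Qed.

(** When s is a homomorphism onto a complement of A, this is the map
a s(x) |-> a^N s(x) for N = #|F| n + 1, because transfer vanishes on the
complement. The formula through transfer makes sense in a nonsplit extension
too. *)
Definition stretch n g : G := emb (transfer g *+ n) * g.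

Lemma stretchM n : {morph stretch n : g h / g * h}.
Proof.
move=> g h; rewrite /stretch transferM mulrnDl -actMn embD emb_act.
by rewrite !mulgA mulgVK.
Qed.

Lemma stretch1 n : stretch n 1 = 1.
Proof. by apply: (@mulgI _ (stretch n 1)); rewrite -stretchM !mulg1. Qed.

Lemma stretchV n g : stretch n g^-1 = (stretch n g)^-1.
Proof. by apply: (@mulgI _ (stretch n g)); rewrite -stretchM !mulgV stretch1. Qed.

Lemma stretch_emb n v : stretch n (emb v) = emb (v *+ (#|F| * n).+1).
Proof. by rewrite /stretch transfer_emb -embD -mulrnA -mulrSr. Qed.

Lemma transfer_stretch n g :
  transfer (stretch n g) = transfer g *+ (#|F| * n).+1.
Proof.
by rewrite transferM act_emb transfer_emb -mulrnA mulnC -mulrSr.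
Qed.

Lemma act_stretch n g v : act (stretch n g) v = act g v.
Proof. by rewrite actM act_emb. Qed.

Lemma card_F_gt0 : (0 < #|F|)%N.
Proof. by apply/card_gt0P; exists (pi 1). Qed.

Section Generators.
Variable S : set G.
Hypothesis genS : generating S.

Definition stretched n n' : set G :=
  [set stretch n x | x in S] `|` [set stretch n' x | x in S].

Lemma letters_stretched n n' l : letters (stretched n n') l ->
  exists2 k, letters S k & l = stretch n k \/ l = stretch n' k.
Proof.
move=> [[[k Sk <-]|[k Sk <-]]|[y [[k Sk <-]|[k Sk <-]] <-]].
- by exists k; [left|left].
- by exists k; [left|right].
- by exists k^-1; [right; exists k|rewrite stretchV; left].
- by exists k^-1; [right; exists k|rewrite !stretchV; right].
Qed.

Lemma generated_image (T : set G) n g :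
  (forall l, S l -> generated T (stretch n l)) -> generated T (stretch n g).
Proof.
move=> ST; have [k] := genS g; elim: k g => [|k IH] g.
  by move=> /prod_of_letters0 ->; rewrite stretch1; apply: generated1.
move=> /prod_of_lettersS[l [h [Sl /IH Th ->]]]; rewrite stretchM.
apply: generatedM => //; case: Sl => [/ST //|[x /ST Tx <-]].
by rewrite stretchV; apply: generatedV.
Qed.

(** With N = #|F| n + 1, the second parameter n N gives the factor
N' = (N - 1) N + 1 on A. It is coprime to N, with the explicit Bezout relation
N' - (N - 1) N = 1, and it is quadratic in N: a factor linear in N would allow
bounded u, v with u N + v N' constant and nonzero. *)
Lemma generating_stretched n : generating (stretched n (n * (#|F| * n).+1)).
Proof.
set n' := (n * _)%N => g; rewrite -/(generated _ g); set T := stretched n n'.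
have gen h : generated T (stretch n h).
  by apply: generated_image => x Sx; apply: generated_letter; left; left; exists x.
have gen' h : generated T (stretch n' h).
  by apply: generated_image => x Sx; apply: generated_letter; left; right; exists x.
(* The Bezout relation: v = N' v - N ((N - 1) v). *)
have gen_emb v : generated T (emb v).
  have -> : emb v = stretch n' (emb v) * (stretch n (emb (v *+ (#|F| * n))))^-1.
    rewrite !stretch_emb -embN -embD; congr (emb _).
    by rewrite -mulrnA /n' mulnA -mulrnBr ?subSnn // leqnSn.
  by apply: generatedM => //; apply: generatedV.
have -> : g = emb (- (transfer g *+ n)) * stretch n g.
  by rewrite mulgA -embD addNr emb0 mul1g.
exact: generatedM.
Qed.

Variable L : seq G.
Hypothesis lettersL : forall l, letters S l -> l \in L.

(** All pairs (u, v) that can occur when transfer of a word of length k is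
separated into contributions of the letters of the two kinds; the recursion
follows transferM for a word l * h. It involves neither n nor n', which is what
makes the pigeonhole possible. *)
Fixpoint transfer_parts k : seq (V * V) :=
  if k is k'.+1 then
    [seq (transfer l + act l p.1, act l p.2) | l <- L, p <- transfer_parts k'] ++
    [seq (act l p.1, transfer l + act l p.2) | l <- L, p <- transfer_parts k']
  else [:: (0, 0)].

Lemma transfer_word n n' k g : prod_of_letters (stretched n n') k g ->
  exists2 p, p \in transfer_parts k &
    transfer g = p.1 *+ (#|F| * n).+1 + p.2 *+ (#|F| * n').+1.
Proof.
elim: k g => [|k IH] g.
  move=> /prod_of_letters0 ->; exists (0, 0); first by rewrite inE.
  by rewrite -emb0 transfer_emb /= !mul0rn addr0.
move=> /prod_of_lettersS[l' [h [/letters_stretched[l Sl lE] /IH[p pk hp] ->]]].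
have lL := lettersL Sl.
case: lE => ->; rewrite transferM transfer_stretch act_stretch hp actD !actMn.
  exists (transfer l + act l p.1, act l p.2); last by rewrite /= mulrnDl addrA.
  by rewrite mem_cat; apply/orP; left; apply/allpairsP; exists (l, p).
exists (act l p.1, transfer l + act l p.2); last by rewrite /= mulrnDl addrCA.
by rewrite mem_cat; apply/orP; right; apply/allpairsP; exists (l, p).
Qed.

(** The length bound M confines the pair (u, v) to one finite list for all n, so
a single pair serves for three values of n. *)
Lemma torsion_transfer_bound g : finite_set S -> G_bound G g -> torsion (transfer g).
Proof.
move=> finS [M _ lM].
pose parts := flatten [seq transfer_parts k | k <- iota 0 M].
pose R n p := transfer g =
  p.1 *+ (#|F| * n).+1 + p.2 *+ (#|F| * (n * (#|F| * n).+1)).+1.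
have Rn n : (0 <= n)%N -> exists2 p, p \in parts & R n p.
  move=> _; have genT := generating_stretched n.
  have finT : finite_set (stretched n (n * (#|F| * n).+1)).
    by rewrite finite_setU; split; apply: finite_image.
  have [/transfer_word[p pk Rp] _] := word_lengthP g genT.
  exists p => //; apply/flattenP; exists (transfer_parts (word_length
    (stretched n (n * (#|F| * n).+1)) g)) => //.
  by apply: map_f; rewrite mem_iota add0n; apply: lM.
have [p _ often] := infinitely_often Rn.
have [n1 _ R1] := often 0%N.
have [n2 n12 R2] := often n1.+1.
have [n3 n23 R3] := often n2.+1.
have Fgt0 := card_F_gt0.
apply: (@torsion_three_values _ _ p.1 p.2
  (#|F| * n1) (#|F| * n2) (#|F| * n3)); rewrite ?ltn_pmul2l // -mulnA.
- by rewrite R1.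
- by rewrite R2.
- by rewrite R3.
Qed.

(** Schreier generators of A, with their conjugates by all coset
representatives: including the conjugates makes the span stable under G. *)
Definition schreier : seq V :=
  [seq act (s y) v | y <- enum F, v <- [seq kappa l x | l <- L, x <- enum F]].

(** The cocycle identity kappaM writes kappa of a word through kappa of its
letters, and each v in A is itself a value of kappa. *)
Lemma zspan_schreier v : zspan schreier v.
Proof.
have span_kappa g h x : zspan schreier (act h (kappa g x)).
  have [k] := genS g; elim: k g h x => [|k IH] g h x.
    by move=> /prod_of_letters0 ->; rewrite -emb0 kappa_emb act0; apply: zspan0.
  move=> /prod_of_lettersS[l [g' [/lettersL lL /IH gk ->]]].
  rewrite kappaM actD -actM; apply: zspanD => //.
  rewrite -(act_pi _ (sK (pi h))); apply/mem_zspan/allpairsP.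
  exists (pi h, kappa l (smul g' x)); split; rewrite ?mem_enum //.
  by apply/allpairsP; exists (l, smul g' x); rewrite mem_enum.
by rewrite -(act1 v) -[in act 1 v](kappa_emb v (pi 1)).
Qed.

(** On a coset, g = a g0 gives c(g) = #|F| a + c(g0), so a is torsion as soon as
c(g) and c(g0) are. *)
Lemma finite_torsion_transfer : finite_set [set g | torsion (transfer g)].
Proof.
have finV := finite_torsion_zspan schreier.
suff : finite_set (\bigcup_(x in [set: F]) [set g | pi g = x /\ torsion (transfer g)]).
  by apply: sub_finite_set => g tg; exists (pi g).
apply: bigcup_finite => [|x _]; first exact: finite_finset.
have [[g0 [g0x tg0]]|none] := pselect (exists g, pi g = x /\ torsion (transfer g));
  last by apply: (sub_finite_set _ (finite_set0 G)) => g gx; apply: none; exists g.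
apply: (sub_finite_set _ (finite_image (fun v => emb v * g0) finV)) => g [gx tg].
have [v gE] : exists v, g = emb v * g0.
  have /piP[u ->] : pi g = pi g0 by rewrite gx.
  by have [v vE] := embJ g0 u; exists v; rewrite vE mulgVK.
exists v => //; split; first exact: zspan_schreier.
move: tg; rewrite gE transferM act_emb transfer_emb => /torsion_of_Dr/(_ tg0).
by apply: torsion_of_Mn; exact: card_F_gt0.
Qed.

End Generators.

Lemma finite_G_bound_extension : finitely_generated G -> finite_set (G_bound G).
Proof.
move=> [S finS genS].
have [L LE] : exists L : seq G, letters S = [set` L].
  by apply/finite_seqP; rewrite finite_setU; split; last exact: finite_image.
have lettersL l : letters S l -> l \in L by rewrite LE.
apply: sub_finite_set (finite_torsion_transfer genS lettersL) => g.
exact: (torsion_transfer_bound genS lettersL finS).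
Qed.

End AbelianExtension.

(** * Reduction to an abelian normal subgroup *)

Section NormalCore.
Variables (G : groupType) (H : groupClosed G).
Local Open Scope group_scope.

Definition core : {pred G} := fun a => `[< forall g, a ^ g \in H >].

Lemma coreP a : reflect (forall g, a ^ g \in H) (a \in core).
Proof. exact: asboolP. Qed.

Lemma core_closed : group_closed core.
Proof.
split=> [|a b /coreP aH /coreP bH]; apply/coreP => g.
  by rewrite conj1g gpred1.
by rewrite conjMg conjVg gpredF.
Qed.

Lemma coreJ a g : a \in core -> a ^ g \in core.
Proof. by move=> /coreP aH; apply/coreP => h; rewrite -conjgM. Qed.

Lemma core_sub a : a \in core -> a \in H.
Proof. by move=> /coreP/(_ 1); rewrite conjg1. Qed.

(** The commutativity proof is an argument so that the additive group structure
can be attached to this type. *)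
Definition core_type of {in H &, forall x y, commute x y} : Type :=
  {a : G | a \in core}.

Hypothesis abelianH : {in H &, forall x y, commute x y}.
Local Notation A := (core_type abelianH).

HB.instance Definition _ := SubType.copy A {a : G | a \in core}.
HB.instance Definition _ := Choice.copy A {a : G | a \in core}.

Let add (a b : A) : A :=
  Sub (val a * val b) (group_closedM core_closed (valP a) (valP b)).
Let zero : A := Sub 1 core_closed.1.
Let opp (a : A) : A :=
  Sub (val a)^-1 (group_closedV core_closed (valP a)).

Let addA : associative add.
Proof. by move=> a b c; apply: val_inj; rewrite /= mulgA. Qed.

Let addC : commutative add.
Proof.
move=> a b; apply: val_inj => /=.
by apply: abelianH; apply/core_sub/valP.
Qed.

Let add0 : left_id zero add.
Proof. by move=> a; apply: val_inj; rewrite /= mul1g. Qed.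

Let addN : left_inverse zero opp add.
Proof. by move=> a; apply: val_inj; rewrite /= mulVg. Qed.

HB.instance Definition _ := GRing.isZmodule.Build A addA addC add0 addN.

(** An element acts on the finite set of cosets of H by left translation, and two
elements act in the same way exactly when they are in the same coset of the
core. So core. So the cosets of the core correspond to the maps that arise.. *)
Lemma core_finite_partition : finite_index H ->
  exists (F : finType) (pi : G -> F), (forall x, exists g, pi g = x) /\
    forall g h, pi g = pi h <-> h^-1 * g \in core.
Proof.
move=> /finite_seqP[X XE].
pose coset (g : G) : set G := [set g * h | h in [set h | h \in H]].
have cosetX g : coset g \in X.
  by have : [set` X] (coset g) by rewrite -XE; exists g.
pose p g : seq_sub X := SeqSub (cosetX g).
have pP g h : p g = p h <-> h^-1 * g \in H.
  have valp k : val (p k) = coset k by [].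
  split=> [gh|hg].
    have : coset h g.
      by rewrite -valp -gh valp; exists 1; rewrite /= ?gpred1 ?mulg1.
    by move=> [k /= kH <-]; rewrite mulKg.
  apply/val_inj; rewrite !valp; apply/seteqP; split=> _ [k /= kH <-].
    exists (h^-1 * g * k) => /=; first by rewrite gpredM.
    by rewrite !mulgA mulgV mul1g.
  exists ((h^-1 * g)^-1 * k) => /=; first by rewrite gpredM ?gpredV.
  by rewrite invgM invgK !mulgA mulgV mul1g.
pose r (x : seq_sub X) : G := xget 1 [set g | p g = x].
have rK g : p (r (p g)) = p g.
  by rewrite /r; case: xgetP => [h _ //|nog]; case: (nog g).
pose q g : {ffun seq_sub X -> seq_sub X} := [ffun x => p (g * r x)].
have qP g h : q g = q h <-> h^-1 * g \in core.
  split=> [/ffunP gh|/coreP hg].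
    apply/coreP => k; have /pP rk := rK k.
    have := gh (p k); rewrite !ffunE => /pP; rewrite invgM.
    set t := r (p k) in rk *; move=> tH.
    have -> : (h^-1 * g) ^ k = (t^-1 * h^-1 * (g * t)) ^ (t^-1 * k).
      by rewrite !conjgE; rewrite invgM invgK !mulgA !mulgK.
    by rewrite gpredJ // -gpredV invgM invgK.
  apply/ffunP => x; rewrite !ffunE; apply/pP.
  by have := hg (r x); rewrite conjgE invgM !mulgA.
(* Restricting to the image makes the quotient map surjective. *)
pose F := {f : {ffun seq_sub X -> seq_sub X} | `[< exists g, q g = f >]}.
have qF g : `[< exists k, q k = q g >] by apply/asboolP; exists g.
exists F, (fun g => Sub (q g) (qF g)); split=> [[f fF]|g h].
  by have /asboolP[g gf] := fF; exists g; apply: val_inj.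
by rewrite -qP; split=> [/(congr1 val)|gh]; [|apply: val_inj].
Qed.

End NormalCore.

Theorem theorem4p2 (G : groupType) :
  finitely_generated G -> virtually_abelian G -> finite_set (G_bound G).
Proof.
move=> fgG [H finH abH].
have [F [pi [pi_surj piP]]] := core_finite_partition finH.
have [s sK] := choice pi_surj.
apply: (@finite_G_bound_extension G (core_type abH) F (fun a => val a) pi s) => //.
- move=> g v; exists (Sub (val v ^ g^-1)%g (coreJ g^-1%g (valP v))).
  by rewrite SubK conjgE invgK mulgA.
- move=> g h; rewrite piP; split=> [hg|[v ->]]; last by rewrite mulKg; apply: valP.
  by exists (Sub (h^-1 * g)%g hg); rewrite SubK mulVKg.
Qed.
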